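(* Let $(\mu_\rho)_{0<\rho<1}$ be a family of translation invariant product probability measures on $\mathbb{N}^{\mathbb{Z}^d}$ satisfying: (i) $G_\rho(t)=\mathbb{E}_{\mu_\rho}(e^{t\eta(0)})<\infty$ for all $t\in\mathbb{R}$; (ii) $\mathbb{E}_{\mu_\rho}(\eta(0))=\rho$; (iii) whenever $a_\rho\ge0$ with $a_\rho\to\infty$ as $\rho\to0$, also $\sup\{x:G_\rho(x)\le a_\rho\}\to\infty$ as $\rho\to0$. Then for all $\rho$ sufficiently small there is a constant $\gamma_d=\gamma_d(d,\rho)>0$ such that for all $n$, $\mathbb{P}_{\mu_\rho}(|\mathcal{W}_\infty(0)|\ge n)\le e^{-\gamma_dn}$.
   Context: Sandpile model on $\mathbb{Z}^d$: $\eta\in\mathbb{N}^{\mathbb{Z}^d}$, site $x$ unstable if $\eta(x)\ge 2d$; toppling $x$ removes $2d$ grains from $x$ and adds one to each of its $2d$ nearest neighbors. A configuration $\eta$ is stabilizable if there is a legal toppling procedure (topplings of unstable sites only, occurring at times in $[0,\infty)$, finitely many per site in bounded time, no infinite backward chain of topplings at neighboring sites at decreasing times) in which every site topples finitely often and the final configuration $\eta_\infty$ is stable ($\eta_\infty(x)\le 2d-1$ for all $x$); the number of topplings at each site and $\eta_\infty$ do not depend on the stabilizing procedure. (Translation invariant measures with density $<d$ are known to be stabilizable.) For stabilizable $\eta$, let $\mathcal{T}_\infty$ be the set of sites that topple at least once during stabilization, $\mathcal{V}_\infty=\{x:\eta_\infty(x)>0\}$, $\mathcal{W}_\infty=\mathcal{T}_\infty\cup\mathcal{V}_\infty$,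 and $\mathcal{W}_\infty(0)$ the connected component (nearest-neighbor adjacency) of $\mathcal{W}_\infty$ containing the origin (empty if $0\notin\mathcal{W}_\infty$); $|\cdot|$ denotes cardinality. *)

(* Defs.v *)
From HB Require Import structures.
From mathcomp Require Import all_boot all_order all_algebra.
From mathcomp Require Import all_classical all_reals all_analysis.

Set Implicit Arguments.
Unset Strict Implicit.
Unset Printing Implicit Defensive.

Import Order.TTheory GRing.Theory Num.Theory.
Local Open Scope classical_set_scope.
Local Open Scope ring_scope.

Definition site (d : nat) := 'rV[int]_d.

Definition unitv (d : nat) (i : 'I_d) : site d := delta_mx 0 i.

Definition adjb (d : nat) (x y : site d) : bool :=
  [exists i : 'I_d, (y == x + unitv i) || (y == x - unitv i)].

Definition config (d : nat) := site d -> nat.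

(* A toppling procedure in which every site topples finitely often is
   described by the (finite) list of toppling times [tau x] of each site x. *)
Definition procedure (R : realType) (d : nat) := site d -> seq R.

Definition ntop (R : realType) d (tau : procedure R d) (x : site d) (t : R) : nat :=
  count (fun s => s < t) (tau x).

Definition conf_before (R : realType) d (eta : config d) (tau : procedure R d)
    (t : R) (x : site d) : int :=
  (eta x)%:Z - (2 * d)%:Z * (ntop tau x t)%:Z
  + \sum_(i < d) ((ntop tau (x + unitv i) t)%:Z + (ntop tau (x - unitv i) t)%:Z).

Definition conf_final (R : realType) d (eta : config d) (tau : procedure R d)
    (x : site d) : int :=
  (eta x)%:Z - (2 * d)%:Z * (size (tau x))%:Z
  + \sum_(i < d) ((size (tau (x + unitv i)))%:Z + (size (tau (x - unitv i)))%:Z).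

Definition stabilizing (R : realType) d (eta : config d) (tau : procedure R d) : Prop :=
  [/\ (forall x, all (fun t => 0 <= t) (tau x) && uniq (tau x)),
      (forall x t, t \in tau x -> (2 * d)%:Z <= conf_before eta tau t x),
      ~ (exists (xs : nat -> site d) (ts : nat -> R),
            forall k, [/\ ts k \in tau (xs k), adjb (xs k) (xs k.+1)
                        & ts k.+1 < ts k])
    & (forall x, conf_final eta tau x < (2 * d)%:Z)].

Definition inW (R : realType) d (eta : config d) (tau : procedure R d) (x : site d) : bool :=
  (tau x != [::]) || (0 < conf_final eta tau x).

Definition inW0 (R : realType) d (eta : config d) (tau : procedure R d) (y : site d) : Prop :=
  exists p : seq (site d),
    [&& path (@adjb d) 0 p, last 0 p == y & all (inW eta tau) (0 :: p)].

Definition card_ge d (A : site d -> Prop) (n : nat) : Prop :=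
  exists s : seq (site d), [/\ uniq s, size s = n & forall y, y \in s -> A y].

Definition bigW0_event (R : realType) d (T : Type) (eta : T -> config d) (n : nat) : set T :=
  [set w | exists tau : procedure R d,
             stabilizing (eta w) tau /\ card_ge (inW0 (eta w) tau) n].

Definition ti_product_law (R : realType) d (dT : measure_display)
    (T : measurableType dT) (P : probability T R) (eta : T -> config d) : Prop :=
  [/\ (forall x k, measurable [set w | eta w x = k]),
      (forall (s : seq (site d * nat)), uniq (map fst s) ->
          P [set w | forall xk, xk \in s -> eta w xk.1 = xk.2]
          = (\prod_(xk <- s) P [set w | eta w xk.1 = xk.2])%E)
    & (forall x k, P [set w | eta w x = k] = P [set w | eta w 0 = k])].

Definition mgf (R : realType) d (dT : measure_display) (T : measurableType dT)
    (P : probability T R) (eta : T -> config d) (t : R) : \bar R :=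
  (\int[P]_w (expR (t * (eta w 0)%:R))%:E)%E.

(* Main.v *)
Require Import Defs.
From HB Require Import structures.
From mathcomp Require Import all_boot all_order all_algebra.
From mathcomp Require Import ring lra zify.
From mathcomp Require Import all_classical all_reals all_analysis.
From mathcomp Require Import measurable_realfun.
Import Order.TTheory GRing.Theory Num.Theory.
Local Open Scope classical_set_scope.
Local Open Scope ring_scope.

(* If the cluster of the origin has at least [n] sites, then finitely many
   topplings witness this: since there is no infinite backward chain, every
   toppling has finitely many ancestors.  Performing only these topplings,
   together with the finitely many sites joining the witnesses to the origin,
   gives a finite connected set [C] containing the origin, with at least [n]
   sites, which no grain enters or leaves.  Every edge with a toppled endpoint
   retains the grain sent by the endpoint that toppled last, and every untoppled
   site of [C] carries a grain, so [C] initially holds at least [|C| / 2] grains.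
   Connected sets with [m] sites are visited by walks of length [2 (m - 1)], so
   there are at most [(2d)^(2m)] of them, and by Chernoff's bound each holds
   [m / 2] grains with probability at most [(G(t) e^(-t/2))^m].  Taking
   [a_rho = 1/rho] in hypothesis (iii) gives [G(2t) <= 1/rho] for small [rho],
   hence [G(t) <= 2], for the value of [t] with [e^(t/2) = 32 d^2]; the terms of
   the union bound are then at most [4^(-m)]. *)

(** * Adjacency and the ancestors of a toppling *)

Lemma adjb_sym {d} (x y : site d) : adjb x y = adjb y x.
Proof.
apply: eq_existsb => i; rewrite orbC; congr (_ || _).
  by rewrite eq_sym subr_eq.
by rewrite -subr_eq eq_sym.
Qed.

Lemma adjbP {d} (x y : site d) :
  reflect (exists i, y = x + unitv i \/ y = x - unitv i) (adjb x y).
Proof.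
apply: (iffP existsP) => -[i].
  by case/orP => /eqP; exists i; [left|right].
by case=> ->; exists i; rewrite eqxx ?orbT.
Qed.

(** Only neighbours count: their topplings supply the grains that [e] needs, while earlier topplings
    of the same site only remove grains. *)
Definition ancestor {R : realType} {d} (tau : procedure R d) (f e : site d * R) : Prop :=
  [/\ f.2 \in tau f.1, adjb e.1 f.1 & f.2 < e.2].

Definition nbrs {d} (x : site d) : seq (site d) :=
  [seq x + unitv i | i <- enum 'I_d] ++ [seq x - unitv i | i <- enum 'I_d].

Lemma mem_nbrs {d} (x y : site d) : (y \in nbrs x) = adjb x y.
Proof.
rewrite mem_cat; apply/idP/adjbP.
  by case/orP => /mapP[i _ ->]; exists i; [left|right].
by case=> i [] ->; apply/orP; [left|right]; apply/mapP; exists i; rewrite ?mem_enum.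
Qed.

(** A toppling that is not accessible has an ancestor that is not accessible, so choice builds an
    infinite backward chain. *)
Lemma Acc_ancestor {R : realType} {d} (eta : config d) (tau : procedure R d) :
  stabilizing eta tau ->
  forall x t, t \in tau x -> Acc (ancestor tau) (x, t).
Proof.
case=> _ _ nochain _ x t xt; apply: contrapT => nacc; apply: nochain.
pose bad (e : site d * R) := e.2 \in tau e.1 /\ ~ Acc (ancestor tau) e.
have step (e : {e | bad e}) : exists f : {e | bad e}, ancestor tau (sval f) (sval e).
  case: e => e [e_tau nacc_e] /=; apply: contrapT => noanc.
  apply: nacc_e; constructor => f f_anc; apply: contrapT => nacc_f.
  case: (f_anc) => f_tau _ _.
  by apply: noanc; exists (exist _ f (conj f_tau nacc_f)).
have [next nextP] := choice step.
pose u k := sval (iter k next (exist _ (x, t) (conj xt nacc))).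
exists (fun k => (u k).1), (fun k => (u k).2) => k.
have [] := nextP (iter k next (exist _ (x, t) (conj xt nacc))).
split=> //.
by rewrite /u; case: (iter k next _) => e [].
Qed.

Definition ancestor_closed {R : realType} {d} (tau : procedure R d)
    (D : seq (site d * R)) : Prop :=
  (forall e, e \in D -> e.2 \in tau e.1) /\
  (forall e f, e \in D -> ancestor tau f e -> f \in D).

(** Closed sets are stable under union and [Q] is monotone, so one finite [D] meets finitely many
    requirements at once. *)
Lemma ancestor_closed_union {R : realType} {d} (tau : procedure R d) (I : eqType)
    (s : seq I) (Q : I -> seq (site d * R) -> Prop) :
  (forall i D D', {subset D <= D'} -> Q i D -> Q i D') ->
  (forall i, i \in s -> exists D, ancestor_closed tau D /\ Q i D) ->
  exists D, ancestor_closed tau D /\ forall i, i \in s -> Q i D.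
Proof.
move=> Qmono; elim: s => [|i s IHs] H; first by exists [::]; split.
have [j js|D [[D1 D2] DQ]] := IHs; first by apply: H; rewrite inE js orbT.
have [D' [[D'1 D'2] D'Q]] := H i (mem_head _ _).
exists (D' ++ D); split.
  split=> [e|e f]; rewrite !mem_cat; first by case/orP => [/D'1|/D1].
  by case/orP => [/D'2|/D2] anc /anc ->; rewrite ?orbT.
move=> j; rewrite inE => /orP[/eqP->|js].
  by apply: Qmono D'Q => e; rewrite mem_cat => ->.
by apply: Qmono (DQ _ js) => e; rewrite mem_cat => ->; rewrite orbT.
Qed.

(** Well-founded induction: a toppling has finitely many parents, since each of its finitely many
    neighbours topples finitely often. *)
Lemma finite_ancestors {R : realType} {d} (tau : procedure R d) e :
  Acc (ancestor tau) e -> e.2 \in tau e.1 ->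
  exists D, ancestor_closed tau D /\ e \in D.
Proof.
elim=> {}e _ IH e_tau.
pose par := [seq (y, t) | y <- nbrs e.1, t <- tau y].
have [| |D [[D1 D2] Dpar]] := @ancestor_closed_union R d tau _ par
    (fun f D => ancestor tau f e -> f \in D).
- by move=> f D D' DD' fD /fD /DD'.
- move=> f _; have [fe|nfe] := pselect (ancestor tau f e).
    case: (fe) => f_tau _ _; have [D [Dc fD]] := IH f fe f_tau.
    by exists D.
  by exists [::].
have De f : ancestor tau f e -> f \in D.
  move=> fe; apply: (Dpar f) => //; case: (fe) => f_tau e_f _.
  by apply/allpairsPdep; exists f.1, f.2; rewrite mem_nbrs; split=> //; case: f {fe f_tau e_f}.
exists (e :: D); split; last exact: mem_head.
split=> [f|f g]; rewrite !inE; first by case/orP => [/eqP->|/D1].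
by case/orP => [/eqP->/De|/D2 fD /fD] ->; rewrite orbT.
Qed.

(** * Closed walks through a finite set of sites *)

(* Inserting an excursion [y -> z -> y] adds one site and two steps, so a walk of
   the prescribed length that visits as many sites of [U] as possible is closed. *)
Lemma exists_closed_walk {d} (U : seq (site d)) : 0 \in U ->
  exists p, [/\ path (@adjb d) 0 p, size p = (2 * (size (undup (0%R :: p))).-1)%N,
     {subset 0 :: p <= U} &
     forall y z, y \in 0 :: p -> z \in U -> adjb y z -> z \in 0 :: p].
Proof.
move=> U0.
pose good p := [/\ path (@adjb d) 0 p, size p = (2 * (size (undup (0%R :: p))).-1)%N &
  {subset 0 :: p <= U}].
(* [k] bounds the number of sites of [U] still unvisited; each excursion lowers that number by
   one. *)
have grow k : (exists p, good p /\ (size (undup U) - size (undup (0%R :: p)) < k)%N) ->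
    exists p, good p /\ forall y z, y \in 0 :: p -> z \in U -> adjb y z -> z \in 0 :: p.
  elim: k => [|k IHk] [p [pg lek]]; first by rewrite ltn0 in lek.
  have [?|/existsNP[y /existsNP[z H]]] :=
    pselect (forall y z, y \in 0 :: p -> z \in U -> adjb y z -> z \in 0 :: p).
    by exists p.
  move/not_implyP: H => [yp /not_implyP[zU /not_implyP[yz /negP zp]]].
  apply: IHk; case: pg => p_path p_size pU.
  case/splitPl: yp p_path p_size zp pU lek => p1 p2 p1y.
  rewrite cat_path p1y => /andP[p1p p2p] sz zp pU lek.
  pose q := p1 ++ z :: y :: p2.
  have memq x : (x \in 0 :: q) = (x == z) || (x \in 0 :: p1 ++ p2).
    have : y \in 0 :: p1 by rewrite -p1y mem_last.
    rewrite /q !(inE, mem_cat); case: (x =P y) => [->|_]; last first.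
      by case: (x == z); rewrite ?orbT.
    by case/orP => ->; rewrite ?orbT.
  have szq : size (undup (0 :: q)) = (size (undup (0%R :: p1 ++ p2))).+1.
    have -> : (size (undup (0%R :: p1 ++ p2))).+1 = size (z :: undup (0%R :: p1 ++ p2)) by [].
    apply/perm_size/uniq_perm; rewrite ?undup_uniq //.
      by rewrite cons_uniq mem_undup zp undup_uniq.
    by move=> x; rewrite mem_undup memq [in RHS]inE mem_undup.
  have qU : {subset 0 :: q <= U}.
    by move=> x; rewrite memq => /orP[/eqP->//|/pU].
  exists q; split.
    split=> //.
      by rewrite /q cat_path p1p /= p1y yz adjb_sym yz p2p.
    have : (0 < size (undup (0%R :: p1 ++ p2)))%N.
      by case: (undup _) (mem_undup (0 :: p1 ++ p2) 0) => //; rewrite mem_head.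
    rewrite szq; move: (size (undup _)) sz => K; rewrite /q !size_cat /=; lia.
  rewrite szq.
  have : (size (undup (0%R :: q)) <= size (undup U))%N.
    by apply: uniq_leq_size (undup_uniq _) _ => x; rewrite !mem_undup => /qU.
  rewrite szq; move: lek; move: (size (undup (0%R :: _))) (size (undup U)) => K N; lia.
have [|p [[p1 p2 p3] p4]] := grow (size (undup U)).+1; last by exists p.
exists [::]; split; last by rewrite ltnS leq_subr.
by split=> // x; rewrite inE => /eqP->.
Qed.

(** * Grain count for a finite ancestor-closed set of topplings *)

Lemma exists_max {R : realType} {s : seq R} : s != [::] ->
  exists2 m, m \in s & all (fun t => t <= m) s.
Proof.
elim: s => // a [|b s] IH _.
  by exists a; rewrite ?mem_head //= lexx.
have [//|m ms mmax] := IH.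
have [am|ma] := leP a m.
  by exists m; [rewrite inE ms orbT|rewrite /= am].
exists a; first exact: mem_head.
rewrite /= lexx /=; apply: sub_all mmax => t /le_trans; apply; exact: ltW.
Qed.

(** Translation is injective, so the terms on the left are distinct terms of the right-hand sum. *)
Lemma sum_shift_le {d} {C : seq (site d)} (v : site d) (f : site d -> nat) :
  uniq C ->
  (\sum_(y <- C | (y + v)%R \in C) f (y + v)%R <= \sum_(y <- C) f y)%N.
Proof.
move=> uC; rewrite -big_filter -(big_map (fun y => y + v) predT f).
set s := map _ _.
have us : uniq s by rewrite map_inj_uniq ?filter_uniq //; exact: addIr.
have sC : {subset s <= C}.
  by move=> x /mapP[y]; rewrite mem_filter => /andP[? _] ->.
have ps : perm_eq s [seq x <- C | x \in s].
  apply: uniq_perm; rewrite ?filter_uniq // => x; rewrite mem_filter.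
  by case xs: (x \in s); rewrite //= sC.
rewrite (perm_big _ ps) /=.
by rewrite big_filter [leqRHS](bigID (mem s)) /= leq_addr.
Qed.

Section Truncation.
Context {R : realType} {d : nat}.
Variables (eta : config d) (tau : procedure R d) (D : seq (site d * R)).
Hypotheses (stab : stabilizing eta tau) (Dc : ancestor_closed tau D).

Definition Dtimes (x : site d) : seq R := [seq t <- tau x | (x, t) \in D].

Definition Dntop (x : site d) : nat := size (Dtimes x).

(** The analogue of [conf_final] when only the topplings in [D] are performed. *)
Definition Dconf (x : site d) : int :=
  (eta x)%:Z - (2 * d)%:Z * (Dntop x)%:Z
  + \sum_(i < d) ((Dntop (x + unitv i))%:Z + (Dntop (x - unitv i))%:Z).

(* [y] keeps a grain sent by [z]: some toppling of [z] in [D]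
   is not earlier than any toppling of [y] in [D]. *)
Definition keeps (y z : site d) : bool :=
  has (fun t => all (fun s => s <= t) (Dtimes y)) (Dtimes z).

(** Compare the last topplings of [y] and [z]; if [z] has none in [D], any toppling of [y]
    qualifies. *)
Lemma keeps_total {y} z : (0 < Dntop y)%N -> keeps y z || keeps z y.
Proof.
rewrite /Dntop -has_predT => Ty.
have [y0 yy0 ymax] : exists2 m, m \in Dtimes y & all (fun t => t <= m) (Dtimes y).
  by apply: exists_max; case: (Dtimes y) Ty.
have [z0|zn0] := eqVneq (Dtimes z) [::].
  by apply/orP; right; apply/hasP; exists y0; rewrite // z0.
have [m mz zmax] := exists_max zn0.
apply/orP; have [ym|my] := leP y0 m; [left|right]; apply/hasP.
  by exists m => //; apply: sub_all ymax => t /le_trans; apply.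
exists y0 => //; apply: sub_all zmax => t /le_trans; apply; exact: ltW.
Qed.

Lemma keeps_Dntop y z : (keeps y z <= Dntop z)%N.
Proof. by rewrite /keeps /Dntop; case: (Dtimes z) => //= a s; case: (_ || _). Qed.

(* [Dconf y] counts at least what [y] receives after its last toppling. *)
Lemma Dconf_ge y (i : 'I_d) :
  ((keeps y (y + unitv i)%R : nat) + keeps y (y - unitv i)%R)%N%:Z <= Dconf y.
Proof.
have [Ty|Ty] := eqVneq (Dtimes y) [::].
  have -> : Dconf y = (eta y)%:Z +
      \sum_(i < d) ((Dntop (y + unitv i))%:Z + (Dntop (y - unitv i))%:Z).
    by rewrite /Dconf {1}/Dntop Ty mulr0 subr0.
  rewrite (bigD1 i) //= addrCA ler_wpDr //.
    by rewrite addr_ge0 // sumr_ge0 // => j _; rewrite addr_ge0.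
  by rewrite PoszD lerD // lez_nat keeps_Dntop.
have [L Ly Lmax] := exists_max Ty.
have [LD Ltau] : (y, L) \in D /\ L \in tau y.
  by move: Ly; rewrite mem_filter => /andP[].
have [tauu legal _ _] := stab; have [_ Danc] := Dc.
(* [D] may lack earlier topplings of [y], hence only an inequality; the successor accounts for the
   toppling at [L], which [ntop] excludes. *)
have yle : (Dntop y <= (ntop tau y L).+1)%N.
  rewrite /Dntop /ntop size_filter.
  have uy : uniq (tau y) by case/andP: (tauu y).
  have cL : count_mem L (tau y) = 1%N by rewrite count_uniq_mem // Ltau.
  apply: (@leq_trans (count (fun s => (s < L)%R) (tau y) + count_mem L (tau y))); last first.
    by rewrite cL addn1.
  rewrite -count_predUI; apply: leq_trans (leq_addr _ _).
  rewrite -[leqRHS]size_filter -[leqLHS]size_filter.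
  apply: uniq_leq_size; rewrite ?filter_uniq // => t; rewrite !mem_filter => /andP[tD tt].
  rewrite tt andbT /= orbC -le_eqVlt; apply: (allP Lmax).
  by rewrite mem_filter tD.
(* Topplings of [z] before [L] are ancestors of [(y, L)], hence in [D]; a kept grain comes from one
   more, not before [L]. *)
have zle z : adjb y z -> (keeps y z + ntop tau z L <= Dntop z)%N.
  move=> yz; rewrite /Dntop /ntop -(count_predC (fun t => t < L)) addnC.
  apply: leq_add.
    rewrite /Dtimes count_filter eq_leq //; apply: eq_in_count => t tz /=.
    by case tL: (t < L); rewrite //= (Danc _ (z, t) LD).
  case kyz : (keeps y z) => //; rewrite -has_count.
  case/hasP: kyz => t tz tmax; apply/hasP; exists t => //=.
  by rewrite -leNgt; exact: (allP tmax).
(* Legality provides [2d] grains just before [L], which pay for the toppling at [L]. *)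
have := legal y L Ltau; rewrite /conf_before /Dconf.
set A := \sum_(i < d) _ => leg.
have : A + ((keeps y (y + unitv i)%R : nat) + keeps y (y - unitv i)%R)%N%:Z <=
   \sum_(i < d) ((Dntop (y + unitv i))%:Z + (Dntop (y - unitv i))%:Z).
  rewrite /A (bigD1 i) //= [leRHS](bigD1 i) //= addrAC lerD //.
    have p1 : adjb y (y + unitv i) by apply/adjbP; exists i; left.
    have p2 : adjb y (y - unitv i) by apply/adjbP; exists i; right.
    by have := zle _ p1; have := zle _ p2; lia.
  apply: ler_sum => j _.
  have p1 : adjb y (y + unitv j) by apply/adjbP; exists j; left.
  have p2 : adjb y (y - unitv j) by apply/adjbP; exists j; right.
  by have := zle _ p1; have := zle _ p2; lia.
nia.
Qed.

Hypothesis d_gt0 : (0 < d)%N.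
(** [C_in] lets no grain enter [C], [C_out] lets none leave, and [C_W] gives each untoppled site a
    source for its grain. *)
Variable C : seq (site d).
Hypotheses (uC : uniq C)
  (C_in : forall y z, y \in C -> adjb y z -> (0 < Dntop z)%N -> z \in C)
  (C_out : forall y z, y \in C -> adjb y z -> (0 < Dntop y)%N -> z \in C)
  (C_W : forall y, y \in C ->
     [\/ (0 < eta y)%N, (0 < Dntop y)%N | exists2 z, adjb y z & (0 < Dntop z)%N]).

(** By [C_in], in each of the [2d] directions [C] receives at most one grain per toppling inside
    [C], and each such toppling removes [2d] grains. *)
Lemma sum_Dconf_le : \sum_(y <- C) Dconf y <= (\sum_(y <- C) eta y)%N%:Z.
Proof.
have shift v : (forall y, adjb y (y + v)) ->
    (\sum_(y <- C) Dntop (y + v)%R <= \sum_(y <- C) Dntop y)%N.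
  move=> vadj; apply: leq_trans (sum_shift_le v Dntop uC).
  rewrite [leqRHS]big_mkcond /= !big_seq; apply: leq_sum => y yC.
  by case: ifPn => // /negP h; rewrite leqNgt; apply/negP => /(C_in _ _ yC (vadj y)).
rewrite /Dconf big_split /= sumrB -mulr_sumr exchange_big /=.
rewrite -[X in X - _ + _](big_morph _ PoszD (erefl 0%:Z)).
rewrite -[X in _ - _ * X + _](big_morph _ PoszD (erefl 0%:Z)).
rewrite -addrA gerDl addrC subr_le0.
apply: (@le_trans _ _ (\sum_(i < d) (2 * \sum_(y <- C) Dntop y)%N%:Z)).
  apply: ler_sum => i _; rewrite big_split /=.
  rewrite -!(big_morph _ PoszD (erefl 0%:Z)) mul2n -addnn PoszD lerD // lez_nat shift //.
    by move=> y; apply/adjbP; exists i; left.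
  by move=> y; apply/adjbP; exists i; right.
rewrite sumr_const card_ord; lia.
Qed.

(** One direction suffices: for each toppled [y], an end of the edge from [y] to [y + unitv i] keeps
    a grain sent by the other, and distinct [y] give distinct edges. *)
Lemma card_toppled_le : (size [seq y <- C | (0 < Dntop y)%N])%:Z <= \sum_(y <- C) Dconf y.
Proof.
pose i := Ordinal d_gt0.
apply: (@le_trans _ _ (\sum_(y <- C)
    (keeps y (y + unitv i)%R + keeps y (y - unitv i)%R)%N)%N%:Z); last first.
  by rewrite (big_morph _ PoszD (erefl 0%:Z)); apply: ler_sum => y _; exact: Dconf_ge.
rewrite lez_nat big_split /= size_filter -sum1_count.
(* A grain kept at the far end of an edge is charged back to [y] by translation. *)
have := sum_shift_le (unitv i) (fun z => keeps z (z - unitv i)%R : nat) uC.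
rewrite -(leq_add2l (\sum_(y <- C) keeps y (y + unitv i)%R)%N).
apply: leq_trans.
rewrite [(\sum_(y <- C | _) keeps (_ + _)%R _)%N]big_mkcond -big_split /=.
rewrite big_mkcond !big_seq; apply: leq_sum => y yC.
case: ifPn => // Ty.
have -> : y + unitv i \in C.
  by apply: C_out yC _ Ty; apply/adjbP; exists i; left.
rewrite addrK.
by have := keeps_total (y + unitv i) Ty; do 2 case: keeps.
Qed.

(** An untoppled site loses nothing, so it still has its initial grain or one received from a
    toppled neighbour; toppled sites contribute at least zero. *)
Lemma card_untoppled_le : (size [seq y <- C | Dntop y == 0%N])%:Z <= \sum_(y <- C) Dconf y.
Proof.
pose i := Ordinal d_gt0.
rewrite size_filter -sum1_count big_mkcond (big_morph _ PoszD (erefl 0%:Z)) !big_seq.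
apply: ler_sum => y yC; case: ifPn => [/eqP Ty|_]; last first.
  by apply: le_trans (Dconf_ge y i).
have -> : Dconf y = (eta y)%:Z +
    \sum_(i < d) ((Dntop (y + unitv i))%:Z + (Dntop (y - unitv i))%:Z).
  by rewrite /Dconf Ty mulr0 subr0.
have ge0 (Q : pred 'I_d) :
    0 <= \sum_(i < d | Q i) ((Dntop (y + unitv i))%:Z + (Dntop (y - unitv i))%:Z).
  by apply: sumr_ge0 => j _; rewrite addr_ge0.
case: (C_W _ yC) => [ey||[z /adjbP[j jz] Tz]].
- by rewrite ler_wpDr // lez_nat.
- by rewrite Ty.
- rewrite (bigD1 j) //=; have := ge0 (fun k => k != j).
  move: (\sum_(_ < _ | _) _) => S S0.
  by case: jz => jz; move: Tz; rewrite jz; lia.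
Qed.

(** Toppled and untoppled sites are each at most as many as the grains; adding the two bounds costs
    the factor 2. *)
Lemma card_le_double_mass : (size C <= 2 * \sum_(y <- C) eta y)%N.
Proof.
have := sum_Dconf_le; have := card_toppled_le; have := card_untoppled_le.
have : (size [seq y <- C | (0 < Dntop y)%N] + size [seq y <- C | Dntop y == 0%N])%N = size C.
  rewrite !size_filter -(count_predC (fun y => 0 < Dntop y)%N); congr addn.
  by apply: eq_count => y /=; rewrite lt0n negbK.
lia.
Qed.

End Truncation.

(** * From a large cluster to a closed walk over many grains *)

(** If neither [x] nor a neighbour topples, the final height of [x] is its initial one. *)
Lemma inW_source {R : realType} {d} {eta : config d} {tau : procedure R d} {x} :
  inW eta tau x ->
  (0 < eta x)%N \/ exists z, (z == x) || adjb x z /\ exists t, t \in tau z.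
Proof.
have ex z : tau z != [::] -> exists t, t \in tau z.
  by case: (tau z) => // t s _; exists t; exact: mem_head.
case/orP => [xn0|]; first by right; exists x; rewrite eqxx; split=> //; exact: ex.
have [//|eta0] := ltnP 0 (eta x); first by left.
rewrite /conf_final => fin; right; apply: contrapT => noz.
have tau0 z : (z == x) || adjb x z -> size (tau z) = 0%N.
  move=> xz; apply/eqP; rewrite size_eq0; apply/eqP; apply: contrapT => /eqP z0.
  by apply: noz; exists z; split=> //; exact: ex.
move: fin; rewrite (tau0 x) ?eqxx // big1 => [|i _]; first lia.
rewrite !tau0 //; apply/orP; right; apply/adjbP; exists i; [by right|by left].
Qed.

Lemma big_cluster_walk {R : realType} {d} {eta : config d} {tau : procedure R d} {n} :
  (0 < d)%N -> (0 < n)%N -> stabilizing eta tau -> card_ge (inW0 eta tau) n ->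
  exists p, let C := undup (0 :: p) in
    [/\ path (@adjb d) 0 p, size p = (2 * (size C).-1)%N, (n <= size C)%N &
        (size C <= 2 * \sum_(y <- C) eta y)%N].
Proof.
move=> d0 n0 stab [s [us sn sW]].
have step y : exists p, y \in s ->
    [&& path (@adjb d) 0 p, last 0 p == y & all (inW eta tau) (0 :: p)].
  have [ys|ys] := boolP (y \in s); last by exists [::].
  by have [p Hp] := sW y ys; exists p.
have [pth pthP] := choice step.
pose F := flatten [seq 0 :: pth y | y <- s].
have FW x : x \in F -> inW eta tau x.
  by case/flatten_mapP => y /pthP /and3P[_ _ /allP]; apply.
(* [D] is finite, yet explains why every site of the chosen paths belongs to the cluster. *)
have [| |D [Dc DF]] := @ancestor_closed_union R d tau _ F
    (fun x D => (0 < eta x)%N \/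
       exists2 e, e \in D & (e.1 == x) || adjb x e.1).
- move=> x D D' DD' [->|[e /DD' eD' xe]]; [by left|by right; exists e].
- move=> x /FW /inW_source[x0|[z [xz [t tz]]]].
    by exists [::]; split=> //; left.
  have [D [Dc zD]] := finite_ancestors tau (z, t) (Acc_ancestor eta tau stab z t tz) tz.
  by exists D; split=> //; right; exists (z, t).
have TD z : (0 < Dntop tau D z)%N -> exists2 e, e \in D & e.1 = z.
  rewrite -has_predT => /hasP[t]; rewrite mem_filter => /andP[zt _] _.
  by exists (z, t).
have DT e : e \in D -> (0 < Dntop tau D e.1)%N.
  move=> eD; rewrite -has_predT; apply/hasP; exists e.2 => //.
  by rewrite mem_filter -surjective_pairing eD (Dc.1 _ eD).
(* Adding the sites toppled in [D] and all their neighbours makes components of [U] closed to grain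
   exchange. *)
pose U := F ++ flatten [seq e.1 :: nbrs e.1 | e <- D].
have UD z y : (0 < Dntop tau D z)%N -> (y == z) || adjb z y -> y \in U.
  move=> /TD[e eD <-] zy; rewrite mem_cat; apply/orP; right.
  by apply/flatten_mapP; exists e => //; rewrite inE mem_nbrs.
have U0 : 0 \in U.
  case: s {us sW step} sn pthP @F FW DF @U UD => [|y s] sn pthP F FW DF U UD.
    by rewrite -sn in n0.
  by rewrite mem_cat /F /= mem_head.
have [p [p_path p_size pU p_closed]] := exists_closed_walk U U0.
(* A path inside [U] that starts on the walk stays on it, so the walk visits all [n] witnesses. *)
have p_last q b : b \in 0 :: p -> path (@adjb d) b q -> {subset q <= U} ->
    last b q \in 0 :: p.
  elim: q b => //= a q IHq b bp /andP[ba qp] qU.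
  apply: IHq => //; last by move=> x xq; apply: qU; rewrite inE xq orbT.
  by apply: p_closed bp _ ba; apply: qU; exact: mem_head.
exists p; split=> //.
  rewrite -sn; apply: uniq_leq_size => // y ys; rewrite mem_undup.
  have /and3P[ypath /eqP <- _] := pthP y ys.
  apply: p_last => //; first exact: mem_head.
  move=> x xy; rewrite mem_cat; apply/orP; left.
  by apply/flatten_mapP; exists y; rewrite // inE xy orbT.
apply: (@card_le_double_mass R d eta tau D) => //.
- exact: undup_uniq.
- move=> y z; rewrite !mem_undup => yp yz Tz.
  by apply: p_closed yp _ yz; apply: UD Tz _; rewrite eqxx.
- move=> y z; rewrite !mem_undup => yp yz Ty.
  by apply: (p_closed y) => //; apply: UD Ty _; rewrite yz orbT.
move=> y; rewrite mem_undup => /pU; rewrite mem_cat => /orP[/DF[]|].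
- by move=> ?; constructor 1.
- case=> e /DT Te /orP[/eqP <-|ye]; [by constructor 2|by constructor 3; exists e.1].
case/flatten_mapP => e /DT Te; rewrite inE mem_nbrs => /orP[/eqP ->|ey].
  by constructor 2.
by constructor 3; exists e.1; rewrite // adjb_sym.
Qed.

(** * Chernoff's bound under the product law *)

Section ProductLaw.
Context {R : realType} {d : nat} {dT : measure_display} {T : measurableType dT}.
Variables (P : probability T R) (eta : T -> config d).
Hypothesis law : ti_product_law P eta.

Lemma measurable_eta {d'} {V : measurableType d'} x (f : nat -> V) :
  measurable_fun setT (fun w => f (eta w x)).
Proof.
have [meta _ _] := law => _ Y mY; rewrite setTI.
have -> : (fun w => f (eta w x)) @^-1` Y =
    \bigcup_(k in [set k | Y (f k)]) [set w | eta w x = k].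
  apply/seteqP; split=> [w /= Yw|w [k /= Yk wk]]; [by exists (eta w x)|by rewrite wk].
by apply: bigcup_measurable => k _; exact: meta.
Qed.

Lemma measurable_prod_eta (s : seq (site d)) (f : nat -> R) :
  measurable_fun setT (fun w => \prod_(x <- s) f (eta w x)).
Proof. by apply: measurable_prod => x _; exact: measurable_eta. Qed.

Definition pinned (l : seq (site d * nat)) : set T :=
  [set w | forall xk, xk \in l -> eta w xk.1 = xk.2].

Lemma pinned_cons xk l : pinned (xk :: l) = pinned l `&` [set w | eta w xk.1 = xk.2].
Proof.
apply/seteqP; split=> w /=.
  move=> H; split; last by apply: H; exact: mem_head.
  by move=> yj yl; apply: H; rewrite inE yl orbT.
by move=> [H Hx] yj; rewrite inE => /orP[/eqP->//|/H].
Qed.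

Lemma measurable_pinned l : measurable (pinned l).
Proof.
have [meta _ _] := law.
elim: l => [|xk l IHl]; last by rewrite pinned_cons; exact: measurableI.
suff -> : pinned [::] = setT by [].
by apply/seteqP; split.
Qed.

Lemma pinned_prob_cons x k l : uniq (x :: map fst l) ->
  (P (pinned ((x, k) :: l)) = P [set w | eta w 0%R = k] * P (pinned l))%E.
Proof.
have [_ indep ti] := law; move=> ul.
rewrite /pinned !indep //=; last by case/andP: ul.
by rewrite big_cons /= ti.
Qed.

Lemma integral_split_eta (x : site d) (A : set T) (h : T -> \bar R) :
  measurable A -> measurable_fun setT h -> (forall w, 0 <= h w)%E ->
  (\int[P]_(w in A) h w =
   \sum_(0 <= k <oo) \int[P]_(w in A `&` [set w | eta w x = k]) h w)%E.
Proof.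
have [meta _ _] := law => mA mh h0.
have {1}-> : A = \bigcup_k (A `&` [set w | eta w x = k]).
  apply/seteqP; split=> [w Aw|w [k _ []]//]; by exists (eta w x).
apply: ge0_integral_bigcup => //.
- by move=> k; apply: measurableI.
- exact: measurable_funTS.
- by move=> i j _ _ [w [[_ /= <-] [_ /= <-]]].
Qed.

Lemma mean_eta_series (f : nat -> R) : (forall k, 0 <= f k) ->
  (\int[P]_w (f (eta w 0%R))%:E =
   \sum_(0 <= k <oo) (f k)%:E * P [set w | eta w 0%R = k])%E.
Proof.
move=> f0; have [meta _ _] := law.
rewrite (integral_split_eta 0) //; last first.
- by move=> w; rewrite lee_fin.
- exact: (measurable_eta 0 (fun k => (f k)%:E)).
apply: eq_eseriesr => k _; rewrite setTI -integral_cst //.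
by apply: eq_integral => w; rewrite inE /= => ->.
Qed.

(* Pinning the coordinates one at a time reduces independence to the finite
   product rule for atoms. *)
Lemma integral_prod_pinned (f : nat -> R) (g : R) (s : seq (site d)) l :
  (forall k, 0 <= f k) -> (\int[P]_w (f (eta w 0%R))%:E <= g%:E)%E ->
  uniq (s ++ map fst l) ->
  (\int[P]_(w in pinned l) (\prod_(x <- s) f (eta w x))%:E
   <= (g ^+ size s)%:E * P (pinned l))%E.
Proof.
move=> f0 fg; have [meta _ _] := law.
have g0 : 0 <= g.
  rewrite -lee_fin (le_trans _ fg) //; apply: integral_ge0 => w _.
  by rewrite lee_fin.
elim: s l => [|x s IHs] l usl.
  rewrite expr0 -integral_cst; last exact: measurable_pinned.
  by rewrite le_eqVlt; apply/orP; left; apply/eqP/eq_integral => w _; rewrite big_nil.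
rewrite (integral_split_eta x); last 3 first.
- exact: measurable_pinned.
- by apply/measurable_EFinP; exact: measurable_prod_eta.
- by move=> w; rewrite lee_fin prodr_ge0.
rewrite exprS EFinM -muleA.
(* Where [eta w x = k] the factor at [x] is the constant [f k]; the induction hypothesis with
   [(x, k)] also pinned bounds the rest, and independence splits off the atom. *)
apply: (@le_trans _ _ (\sum_(0 <= k <oo) ((g ^+ size s)%:E * P (pinned l)) *
    ((f k)%:E * P [set w | eta w 0%R = k]))%E).
  apply: lee_nneseries => [k _ _|k _].
    by apply: integral_ge0 => w _; rewrite lee_fin prodr_ge0.
  rewrite -(pinned_cons (x, k)).
  have -> : (\int[P]_(w in pinned ((x, k) :: l)) (\prod_(y <- x :: s) f (eta w y))%:E =
      \int[P]_(w in pinned ((x, k) :: l)) ((f k)%:E * (\prod_(y <- s) f (eta w y))%:E))%E.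
    apply: eq_integral => w; rewrite inE pinned_cons => -[_ /= wk].
    by rewrite big_cons wk EFinM.
  rewrite ge0_integralZl //=; last 4 first.
  - exact: measurable_pinned.
  - by apply/measurable_EFinP; apply: measurable_funTS; exact: measurable_prod_eta.
  - by move=> w _; rewrite lee_fin prodr_ge0.
  - by rewrite lee_fin.
  have uk : uniq (s ++ map fst ((x, k) :: l)).
    by move: usl; rewrite -[(x :: s) ++ _]/([:: x] ++ s ++ _) uniq_catCA.
  have ux : uniq (x :: map fst l) by move: uk; rewrite cat_uniq => /and3P[].
  apply: (le_trans (lee_wpmul2l _ (IHs _ uk))); first by rewrite lee_fin.
  rewrite pinned_prob_cons //.
  by rewrite muleCA (muleA (f k)%:E) -[leRHS]muleA (muleC (P (pinned l))).
(* A finite constant can leave the series, which then sums to the mean of [f]. *)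
have fin : P (pinned l) \is a fin_num by exact: fin_num_measure (measurable_pinned l).
rewrite -(fineK fin) -EFinM nneseriesZl; last first.
  by move=> k _; rewrite mule_ge0 // lee_fin.
rewrite -mean_eta_series // muleC; apply: lee_wpmul2r => //.
by rewrite lee_fin mulr_ge0 ?exprn_ge0 // fine_ge0.
Qed.

(** Markov's inequality for the product, whose mean is bounded by the previous lemma with nothing
    pinned. *)
Lemma chernoff_prod (f : nat -> R) (g c : R) (s : seq (site d)) :
  (forall k, 0 <= f k) -> (\int[P]_w (f (eta w 0%R))%:E <= g%:E)%E ->
  uniq s -> 0 < c ->
  (P [set w | (c ^+ size s <= \prod_(x <- s) f (eta w x))%R] <= ((g / c) ^+ size s)%:E)%E.
Proof.
move=> f0 fg us c0; set B := [set w | _].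
have mB : measurable B.
  rewrite /B -[X in measurable X]setTI.
  by apply: measurable_fun_le => //; exact: measurable_prod_eta.
rewrite expr_div_n mulrC EFinM lee_pdivlMl ?exprn_gt0 //.
rewrite -integral_cst //.
have := @integral_prod_pinned f g s [::] f0 fg; rewrite cats0 => /(_ us).
have -> : pinned [::] = setT by apply/seteqP; split.
rewrite probability_setT mule1; apply: le_trans.
apply: (@le_trans _ _ (\int[P]_(w in B) (\prod_(x <- s) f (eta w x))%:E)%E).
  apply: ge0_le_integral => //=.
  - by move=> w _; rewrite lee_fin exprn_ge0 // ltW.
  - by apply/measurable_EFinP; apply: measurable_funTS; exact: measurable_prod_eta.
apply: ge0_subset_integral => //.
  by apply/measurable_EFinP; exact: measurable_prod_eta.
by move=> w _; rewrite lee_fin prodr_ge0.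
Qed.

End ProductLaw.

(** * Union bound over walks *)

(** Labelling steps by direction and sign makes the walks of a given length a finite type with
    [(2d)^length] elements. *)
Definition walk_step {d} (x : site d) (u : 'I_d * bool) : site d :=
  if u.2 then x + unitv u.1 else x - unitv u.1.

Lemma path_walk {d} (x : site d) p : path (@adjb d) x p ->
  exists2 u, size u = size p & p = scanl walk_step x u.
Proof.
elim: p x => [|y p IHp] x /=; first by exists [::].
case/andP => /adjbP[i xy] /IHp[u up pu].
exists ((i, y == x + unitv i) :: u); rewrite /= ?up //.
have <- : y = walk_step x (i, y == x + unitv i).
  by rewrite /walk_step /=; case: eqP => // ne; case: xy.
by rewrite -pu.
Qed.

Lemma bigsetU_measure_le {R : realType} {dT} {T : measurableType dT}
    (mu : {measure set T -> \bar R}) (I : Type) (r : seq I) (F : I -> set T) (b : R) :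
  (forall i, measurable (F i)) -> (forall i, mu (F i) <= b%:E)%E ->
  (mu (\big[setU/set0]_(i <- r) F i) <= ((size r)%:R * b)%:E)%E.
Proof.
move=> mF Fb; elim: r => [|i r IHr]; first by rewrite big_nil measure0 mul0r.
rewrite big_cons /= -natr1 mulrDl mul1r addrC EFinD.
apply: le_trans (measureU2 _ _ _) _ => //; first exact: bigsetU_measurable.
by apply: leeD; [exact: Fb|exact: IHr].
Qed.

Section ClusterTail.
Context {R : realType} {d : nat} {dT : measure_display} {T : measurableType dT}.
Variables (P : probability T R) (eta : T -> config d).
Hypotheses (law : ti_product_law P eta) (d_gt0 : (0 < d)%N).

(** Chosen so that [(2d)^2 * (2 / c) = 1/4]: the walk count and the Chernoff factor then combine to
    [4^-m]. *)
Let c : R := 32 * d%:R ^+ 2.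

Hypothesis mean_le2 : (\int[P]_w (c ^+ (2 * eta w 0%R))%:E <= 2%:E)%E.

Definition visited (u : seq ('I_d * bool)) : seq (site d) :=
  undup (0 :: scanl walk_step 0 u).

(** The inequality is [m <= 2 * (number of grains)] in the exponent of [c], the form that Markov's
    inequality takes. *)
Definition heavy (m : nat) (u : seq ('I_d * bool)) : set T :=
  [set w | size (visited u) = m /\
    c ^+ size (visited u) <= \prod_(x <- visited u) c ^+ (2 * eta w x)].

Definition heavy_walk (m : nat) : set T :=
  \big[setU/set0]_(u <- enum {: (2 * m.-1).-tuple ('I_d * bool)}) heavy m u.

Let c_ge1 : 1 <= c.
Proof.
have : 1 <= d%:R :> R by rewrite ler1n.
by rewrite /c; nra.
Qed.

Lemma measurable_heavy m u : measurable (heavy m u).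
Proof.
rewrite /heavy; have [um|um] := eqVneq (size (visited u)) m; last first.
  rewrite (_ : [set _ | _] = set0) //; apply/seteqP; split=> w //= -[].
  by move/eqP: um.
rewrite (_ : [set _ | _] = setT `&`
    [set w | c ^+ size (visited u) <= \prod_(x <- visited u) c ^+ (2 * eta w x)]).
  apply: measurable_fun_le => //.
  exact: (@measurable_prod_eta _ _ _ _ _ _ law _ (fun k => c ^+ (2 * k))).
by apply/seteqP; split=> w /= [].
Qed.

Lemma heavy_le m u : (P (heavy m u) <= ((2 / c) ^+ m)%:E)%E.
Proof.
have [um|um] := eqVneq (size (visited u)) m; last first.
  rewrite (_ : heavy m u = set0).
    by rewrite measure0 lee_fin exprn_ge0 // divr_ge0 // (le_trans ler01).
  by apply/seteqP; split=> w //= -[]; move/eqP: um.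
have := @chernoff_prod _ _ _ _ P eta law (fun k => c ^+ (2 * k)) 2 c (visited u).
rewrite um => chern; apply: le_trans (chern _ mean_le2 _ _).
- apply: le_measure; rewrite ?inE; first exact: measurable_heavy.
    rewrite -[X in measurable X]setTI; apply: measurable_fun_le => //.
    exact: (@measurable_prod_eta _ _ _ _ _ _ law _ (fun k => c ^+ (2 * k))).
  by move=> w [_]; rewrite um.
- by move=> k; rewrite exprn_ge0 // (le_trans ler01).
- exact: undup_uniq.
- exact: lt_le_trans ltr01 c_ge1.
Qed.

Lemma measurable_heavy_walk m : measurable (heavy_walk m).
Proof. by apply: bigsetU_measurable => u _; exact: measurable_heavy. Qed.

Lemma heavy_walk_le m : (P (heavy_walk m) <= (4^-1 ^+ m)%:E)%E.
Proof.
apply: le_trans (bigsetU_measure_le P _ _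
  (fun u : (2 * m.-1).-tuple ('I_d * bool) => heavy m u) _
  (fun u => measurable_heavy m u) (fun u => heavy_le m u)) _.
rewrite lee_fin -cardE card_tuple card_prod card_ord card_bool.
have d0 : (0 : R) < d%:R by rewrite ltr0n.
have q0 : 0 <= 2 / c by rewrite divr_ge0 // (le_trans ler01).
have -> : 4^-1 = (d%:R * 2) ^+ 2 * (2 / c) :> R.
  by rewrite /c; field; rewrite gt_eqF.
rewrite [leRHS]exprMn -exprM ler_wpM2r ?exprn_ge0 //.
(* The length [2 (m - 1)] is rounded up to [2m]. *)
rewrite -natrM -natrX ler_nat leq_pexp2l ?muln_gt0 ?d_gt0 //.
by rewrite leq_mul2l leq_pred orbT.
Qed.

(** The set visited by the walk may exceed [n] sites; [k] is the excess. *)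
Lemma bigW0_sub n : (0 < n)%N ->
  bigW0_event R eta n `<=` \bigcup_k heavy_walk (n + k).
Proof.
move=> n0 w [tau [stab big]].
have [p /= [p_path p_size nC mass]] := big_cluster_walk d_gt0 n0 stab big.
have [u up pu] := path_walk _ _ p_path.
have Cu : undup (0 :: p) = visited u by rewrite /visited -pu.
rewrite -/(undup (0 :: p)) {}Cu in p_size nC mass.
exists (size (visited u) - n)%N => //; rewrite subnKC //.
have us : size u == (2 * (size (visited u)).-1)%N by rewrite up p_size.
rewrite /heavy_walk -bigcup_seq.
exists (Tuple us); first by rewrite /= mem_enum.
split=> //=.
rewrite -expr_sum ler_weXn2l //.
by rewrite -big_distrr.
Qed.

Lemma cluster_tail n : exists B : set T,
  [/\ measurable B, bigW0_event R eta n `<=` B & (P B <= (2^-1 ^+ n)%:E)%E].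
Proof.
case: n => [|n]; first by exists setT; split; rewrite // probability_setT expr0.
exists (\bigcup_k heavy_walk (n.+1 + k)).
have mB : measurable (\bigcup_k heavy_walk (n.+1 + k)).
  by apply: bigcupT_measurable => k; exact: measurable_heavy_walk.
split=> //; first exact: bigW0_sub.
apply: le_trans (generalized_Boole_inequality _ _ mB) _.
  by move=> k; exact: measurable_heavy_walk.
(* The geometric series of [2^-(n+1) * 2^-(k+1)] dominates, because [4^-m <= 2^-(m+1)] for
   [m = n+1+k >= 1]. *)
apply: le_trans (@epsilon_trick0 R (2^-1 ^+ n.+1) xpredT _); last first.
  by rewrite exprn_ge0.
apply: lee_nneseries => // k _; apply: le_trans (heavy_walk_le _) _.
rewrite lee_fin natrX -exprVn -exprD.
rewrite (_ : 4^-1 = 2^-1 ^+ 2 :> R); last by rewrite exprVn; congr (_^-1); ring.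
rewrite -exprM ler_wiXn2l //; last by lia.
by rewrite invf_le1 ?ler1n.
Qed.

End ClusterTail.

(** * The exponential moment at small density *)

Section SmallDensity.
Context {R : realType} {d : nat} {dT : measure_display} {T : measurableType dT}.
Variables (P : probability T R) (eta : T -> config d).
Hypothesis law : ti_product_law P eta.

Lemma mgf_le s t : s <= t -> (mgf P eta s <= mgf P eta t)%E.
Proof.
move=> st; apply: ge0_le_integral; first exact: measurableT.
- by move=> w _; rewrite lee_fin expR_ge0.
- exact: (measurable_eta P eta law 0 (fun k => (expR (s * k%:R))%:E)).
- exact: (measurable_eta P eta law 0 (fun k => (expR (t * k%:R))%:E)).
- by move=> w _; rewrite lee_fin ler_expR ler_wpM2r.
Qed.

(* For [k >= 1], AM-GM gives [y <= (rho/2) y^2 + 1/(2 rho)] with [y = e^(tk)]. *)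
Lemma mgf_le2 (rho t : R) : 0 < rho ->
  (\int[P]_w ((eta w 0%R)%:R)%:E = rho%:E)%E ->
  (mgf P eta (2 * t) <= (rho^-1)%:E)%E -> (mgf P eta t <= 2%:E)%E.
Proof.
move=> rho0 mean mgf2.
pose f1 k : \bar R := (expR (2 * t * k%:R))%:E.
pose f2 k : \bar R := (k%:R)%:E.
have mf1 : measurable_fun setT (fun w => f1 (eta w 0)).
  exact: (measurable_eta P eta law 0 f1).
have mf2 : measurable_fun setT (fun w => f2 (eta w 0)).
  exact: (measurable_eta P eta law 0 f2).
have f10 k : (0 <= f1 k)%E by rewrite lee_fin expR_ge0.
have f20 k : (0 <= f2 k)%E by rewrite lee_fin.
have a0 : 0 <= rho / 2 by rewrite divr_ge0 // ltW.
have b0 : 0 <= (2 * rho)^-1 by rewrite invr_ge0 mulr_ge0 // ltW.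
(* The constant 1 covers [k = 0]; the factor [k >= 1] put on [1/(2 rho)] turns that term into a
   multiple of the density. *)
apply: (@le_trans _ _ (\int[P]_w (1%:E + ((rho / 2)%:E * f1 (eta w 0%R) +
    ((2 * rho)^-1)%:E * f2 (eta w 0%R))))%E).
  apply: ge0_le_integral; first exact: measurableT.
  - by move=> w _; rewrite lee_fin expR_ge0.
  - exact: (measurable_eta P eta law 0 (fun k => (expR (t * k%:R))%:E)).
  - exact: (measurable_eta P eta law 0
      (fun k => 1%:E + ((rho / 2)%:E * f1 k + ((2 * rho)^-1)%:E * f2 k))%E).
  move=> w _; rewrite /f1 /f2 -!EFinM -!EFinD lee_fin.
  case: (eta w 0) => [|k]; first by rewrite !mulr0 !expR0 addr0 lerDl mulr1.
  have -> : expR (2 * t * k.+1%:R) = expR (t * k.+1%:R) ^+ 2.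
    by rewrite -expRM_natl mulrA.
  move: (expR _) => y.
  have k1 : 1 <= k.+1%:R :> R by rewrite ler1n.
  have : (2 * rho)^-1 * 1 <= (2 * rho)^-1 * k.+1%:R by rewrite ler_wpM2l.
  have e : rho / 2 * y ^+ 2 + (2 * rho)^-1 - y = rho / 2 * (y - rho^-1) ^+ 2.
    by field; rewrite gt_eqF.
  have : 0 <= rho / 2 * (y - rho^-1) ^+ 2 by rewrite mulr_ge0 ?sqr_ge0.
  rewrite -e; lra.
have mZ1 : measurable_fun setT (fun w => (rho / 2)%:E * f1 (eta w 0%R))%E.
  exact: (measurable_eta P eta law 0 (fun k => (rho / 2)%:E * f1 k)%E).
have mZ2 : measurable_fun setT (fun w => ((2 * rho)^-1)%:E * f2 (eta w 0%R))%E.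
  exact: (measurable_eta P eta law 0 (fun k => ((2 * rho)^-1)%:E * f2 k)%E).
rewrite ge0_integralD //; last 2 first.
- by move=> w _; rewrite adde_ge0 // mule_ge0 // lee_fin.
- exact: emeasurable_funD.
rewrite ge0_integralD //; last 2 first.
- by move=> w _; rewrite mule_ge0 // lee_fin.
- by move=> w _; rewrite mule_ge0 // lee_fin.
rewrite integral_cst //.
rewrite !ge0_integralZl // ?lee_fin // mean.
(* The three terms contribute at most 1, 1/2 and 1/2. *)
apply: (@le_trans _ _ (1%:E + ((rho / 2)%:E * (rho^-1)%:E + ((2 * rho)^-1)%:E * rho%:E))%E).
  apply: leeD; first by rewrite mul1e; exact: probability_le1.
  by apply: leeD => //; apply: lee_wpmul2l => //; rewrite lee_fin.
rewrite -!EFinM -!EFinD lee_fin.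
have -> : 1 + (rho / 2 * rho^-1 + (2 * rho)^-1 * rho) = 2.
  by field; rewrite gt_eqF.
by [].
Qed.

End SmallDensity.

(** * Choice of constants and conclusion *)

(** In dimension zero, stability would require a negative number of grains. *)
Lemma stabilizing_dim_gt0 {R : realType} {d} {eta : config d} {tau : procedure R d} :
  stabilizing eta tau -> (0 < d)%N.
Proof.
case: d eta tau => // eta tau [_ _ _ /(_ 0)].
by rewrite /conf_final big_ord0 muln0 mul0r subr0 addr0.
Qed.

Lemma inv_cvg_right0 {R : realType} : x^-1 @[x --> (0 : R)^'+] --> +oo.
Proof.
apply/cvgryPge => A; have [A0|A0] := leP A 0; near=> x;
  have x0 : 0 < x by near: x; exact: nbhs_right_gt.
  by rewrite (le_trans A0) // invr_ge0 ltW.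
rewrite -[A]invrK lef_pV2 ?posrE ?invr_gt0 // ltW //.
by near: x; apply: nbhs_right_lt; rewrite invr_gt0.
Unshelve. all: end_near. Qed.

Theorem theorem4p5 (R : realType) (d : nat) (dT : measure_display)
  (T : measurableType dT) (P : R -> probability T R) (eta : T -> config d) :
  (forall rho, 0 < rho < 1 -> ti_product_law (P rho) eta) ->
  (forall rho, 0 < rho < 1 -> forall t : R, (mgf (P rho) eta t < +oo)%E) ->
  (forall rho, 0 < rho < 1 -> (\int[P rho]_w ((eta w 0)%:R)%:E)%E = rho%:E) ->
  (forall a : R -> R, (forall rho, 0 < rho < 1 -> 0 <= a rho) ->
     a x @[x --> 0^'+] --> +oo ->
     ereal_sup [set x%:E | x in [set x : R | (mgf (P rho) eta x <= (a rho)%:E)%E]]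
       @[rho --> 0^'+] --> +oo%E) ->
  exists rho0 : R, 0 < rho0 /\
    forall rho, 0 < rho < rho0 -> rho < 1 ->
      exists gamma : R, 0 < gamma /\
        forall n : nat, exists B : set T,
          [/\ measurable B, bigW0_event R eta n `<=` B
            & (P rho B <= (expR (- (gamma * n%:R)))%:E)%E].
Proof.
move=> law _ mean growth.
have [d0|d_gt0] := posnP d.
  exists 1; split=> // rho _ _; exists 1; split=> // n; exists set0; split=> //.
    by move=> w [tau [/stabilizing_dim_gt0 /lt0n_neq0]]; case/eqP.
  by rewrite measure0 lee_fin expR_ge0.
pose c : R := 32 * d%:R ^+ 2.
(* This makes [e^(t k) = c^(2k)]. *)
pose t := 2 * ln c.
have c0 : 0 < c by rewrite mulr_gt0 // exprn_gt0 // ltr0n.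
have cE k : expR (t * k%:R) = c ^+ (2 * k).
  by rewrite mulrC /t expRM_natl mulrC expRM_natr lnK ?posrE // exprM.
have inv_ge0 (rho : R) : 0 < rho < 1 -> 0 <= rho^-1.
  by case/andP => ? _; rewrite invr_ge0 ltW.
(* For small [rho] the supremum exceeds [2t], so some [x > 2t] has [G(x) <= 1/rho]; monotonicity
   carries the bound to [2t]. *)
have := cvgey_gt (growth (fun rho => rho^-1) inv_ge0 inv_cvg_right0) (2 * t).
case=> e /= e0 near0; exists e; split=> // rho /andP[rho0 rhoe] rho1.
have rho01 : 0 < rho < 1 by rewrite rho0.
have [|_ [x mgfx <-]] := ereal_sup_gt (near0 rho _ rho0).
  by rewrite /ball_ /= sub0r normrN gtr0_norm.
rewrite lte_fin => /ltW tx.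
have mgf2t := le_trans (mgf_le _ _ (law _ rho01) _ _ tx) mgfx.
have := mgf_le2 _ _ (law _ rho01) _ _ rho0 (mean _ rho01) mgf2t.
rewrite /mgf; under eq_integral do rewrite cE.
move=> mean_le2.
(* The rate comes from the tail bound [2^-n], the same for all small [rho]. *)
exists (ln 2); split; first by rewrite ln_gt0 // ltr1n.
move=> n; have [B [mB WB PB]] := cluster_tail _ _ (law _ rho01) d_gt0 mean_le2 n.
exists B; split=> //; apply: le_trans PB _.
by rewrite lee_fin expRN mulrC expRM_natl lnK ?posrE // exprVn.
Qed.
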